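(* Let $x_e\in\mathbb{R}^n$ and suppose there exists $u_e\in\mathcal{B}(x_e)\cap\operatorname{int}\Omega(x_e)$. Then there exist a neighborhood $\mathcal{N}_{x_e}$ of $x_e$ and a constant $\varepsilon>0$ such that $$u_e+[-\varepsilon,\varepsilon]^m\subset\Omega(x)\qquad\text{for all }x\in\mathcal{N}_{x_e}.$$ Moreover, under the change of variables $u=u_e+\eta$, the original system contains, on $\mathcal{N}_{x_e}$, the shifted symmetric-control system $$\dot x=\tilde f_0(x)+\sum_{i=1}^m\eta_i g_i(x),\qquad \eta\in[-\varepsilon,\varepsilon]^m,\qquad \tilde f_0(x):=f_0(x)+\sum_{i=1}^m u_{e,i}g_i(x),$$ that is, every trajectory of the shifted system remaining in $\mathcal{N}_{x_e}$ with control $\eta(\cdot)$ is an admissible trajectory of the original system with control $u=u_e+\eta$; and $\tilde f_0(x_e)=0$.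
   Context: Let $f_0,g_1,\dots,g_m$ be vector fields on $\mathbb{R}^n$ of class $C^\nu$, $\nu\in\mathbb{Z}_{\ge1}\cup\{\infty,\omega\}$. The original system is $$\dot x(t)=f_0(x(t))+\sum_{i=1}^m u_i(t)g_i(x(t)),\qquad u(t)\in\Omega(x(t)),\qquad \Omega(x)=\prod_{i=1}^m[\underline u_i(x),\overline u_i(x)]\subset\mathbb{R}^m .$$ Standing assumptions: $\underline u_i,\overline u_i:\mathbb{R}^n\to\mathbb{R}$ are continuous with $\underline u_i(x)<\overline u_i(x)$ for all $x,i$, and either $0<\underline u_i(x)$ for all $x,i$, or $\overline u_i(x)<0$ for all $x,i$. Admissible balancing set: $\mathcal{B}(x_e):=\{u\in\Omega(x_e):f_0(x_e)+\sum_{i=1}^m u_ig_i(x_e)=0\}$. Admissible trajectory of the original system: an absolutely continuous $x:[0,T]\to\mathbb{R}^n$ for which there is $u\in L^\infty(0,T;\mathbb{R}^m)$ with $u(t)\in\Omega(x(t))$ and the differential equation holding for a.e. $t$. Trajectories of the shifted system are defined likewise with $\eta\in L^\infty(0,T;\mathbb{R}^m)$, $\eta(t)\in[-\varepsilon,\varepsilon]^m$ a.e. *)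

(* Defs.v *)
From HB Require Import structures.
From mathcomp Require Import all_boot all_order all_algebra.
From mathcomp Require Import all_classical all_reals all_analysis.

Set Implicit Arguments.
Unset Strict Implicit.
Unset Printing Implicit Defensive.
Import Order.TTheory GRing.Theory Num.Theory.
Import numFieldNormedType.Exports.

Local Open Scope classical_set_scope.
Local Open Scope ring_scope.

Inductive smoothness : Type :=
| FiniteOrder (k : nat) of (1 <= k)%N
| Infinity
| Analytic.

Section Regularity.
Context {R : realType} {n p : nat}.
Implicit Types f : 'rV[R]_n -> 'rV[R]_p.

(* All iterated partial derivatives of order at most k exist and are
   continuous; delta_mx 0 i is the i-th vector of the canonical basis. *)
Fixpoint class_Ck (k : nat) f : Prop :=
  continuous f /\
  match k with
  | 0%N => True
  | k'.+1 => forall i : 'I_n,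
      (forall x, derivable f x (delta_mx 0 i)) /\
      class_Ck k' (fun x => 'D_(delta_mx 0 i) f x)
  end.

Definition monomial (h : 'rV[R]_n) (alpha : {ffun 'I_n -> nat}) : R :=
  \prod_(i < n) h 0 i ^+ alpha i.

(* Sum of F over the finite box of multi-indices alpha with alpha i < N for
   all i; these boxes exhaust all the multi-indices as N grows. *)
Definition box_sum {V : zmodType} (F : {ffun 'I_n -> nat} -> V) (N : nat) : V :=
  \sum_(alpha : {ffun 'I_n -> 'I_N}) F [ffun i => nat_of_ord (alpha i)].

(* Near every point, f is the sum of an absolutely convergent power series.
   Because of absolute convergence, summing over boxes loses no generality. *)
Definition real_analytic f : Prop :=
  forall x0 : 'rV[R]_n,
  exists a : {ffun 'I_n -> nat} -> 'rV[R]_p,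
  \forall x \near x0,
    cvgn (box_sum (fun alpha => `|monomial (x - x0) alpha *: a alpha|)) /\
    box_sum (fun alpha => monomial (x - x0) alpha *: a alpha) N
      @[N --> \oo] --> f x.

Definition of_class (nu : smoothness) f : Prop :=
  match nu with
  | @FiniteOrder k _ => class_Ck k f
  | Infinity => forall k, class_Ck k f
  | Analytic => real_analytic f
  end.

End Regularity.

Section ControlSystems.
Context {R : realType} {n m : nat}.

Definition rhs (f0 : 'rV[R]_n -> 'rV[R]_n)
    (g : 'I_m -> 'rV[R]_n -> 'rV[R]_n)
    (x : 'rV[R]_n) (u : 'rV[R]_m) : 'rV[R]_n :=
  f0 x + \sum_(i < m) u 0 i *: g i x.

Definition control_box (ulo uhi : 'I_m -> 'rV[R]_n -> R) (x : 'rV[R]_n) :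
    set 'rV[R]_m :=
  [set u | forall i, ulo i x <= u 0 i <= uhi i x].

Definition sym_cube (eps : R) : set 'rV[R]_m :=
  [set eta | forall i, - eps <= eta 0 i <= eps].

Definition balancing_set (f0 : 'rV[R]_n -> 'rV[R]_n)
    (g : 'I_m -> 'rV[R]_n -> 'rV[R]_n)
    (Omega : 'rV[R]_n -> set 'rV[R]_m)
    (xe : 'rV[R]_n) : set 'rV[R]_m :=
  [set u | Omega xe u /\ rhs f0 g xe u = 0].

Definition shifted_drift (f0 : 'rV[R]_n -> 'rV[R]_n)
    (g : 'I_m -> 'rV[R]_n -> 'rV[R]_n)
    (ue : 'rV[R]_m) (x : 'rV[R]_n) : 'rV[R]_n :=
  f0 x + \sum_(i < m) ue 0 i *: g i x.

Definition absolutely_continuous (a b : R) (x : R -> 'rV[R]_n) : Prop :=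
  forall e : R, 0 < e -> exists2 d : R, 0 < d &
  forall (N : nat) (s t : 'I_N -> R),
    (forall k, a <= s k /\ s k <= t k /\ t k <= b) ->
    trivIset setT (fun k => [set` `]s k, t k[]) ->
    \sum_(k < N) (t k - s k) < d ->
    \sum_(k < N) `|x (t k) - x (s k)| < e.

(* Membership in L^oo(0, T; R^m): each component, extended by 0 outside
   ]0, T[, is measurable and essentially bounded on the real line. *)
Definition Linfty (T : R) (u : R -> 'rV[R]_m) : Prop :=
  forall i : 'I_m,
    ((fun t => u t 0 i) \_ [set` `]0, T[]) \in Lfun (@lebesgue_measure R) +oo%E.

(* x is a trajectory on [0, T], with control u, of the system with drift f0,
   control fields g and state-dependent control set Omega. Only the values of
   x on [0, T] and of u on ]0, T[ matter. *)
Definition trajectory (f0 : 'rV[R]_n -> 'rV[R]_n)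
    (g : 'I_m -> 'rV[R]_n -> 'rV[R]_n)
    (Omega : 'rV[R]_n -> set 'rV[R]_m) (T : R)
    (x : R -> 'rV[R]_n) (u : R -> 'rV[R]_m) : Prop :=
  [/\ absolutely_continuous 0 T x,
      Linfty T u &
      {ae lebesgue_measure, forall t : R, 0 < t < T ->
         Omega (x t) (u t) /\ is_derive t 1 x (rhs f0 g (x t) (u t))}].

End ControlSystems.

(* Main.v *)
Require Import Defs.
From HB Require Import structures.
From mathcomp Require Import all_boot all_order all_algebra.
From mathcomp Require Import all_classical all_reals all_analysis.
From mathcomp Require Import lra.
Import Order.TTheory GRing.Theory Num.Theory.
Import numFieldNormedType.Exports.
Local Open Scope classical_set_scope.
Local Open Scope ring_scope.

(** An interior point [ue] of the box at [xe] keeps a margin [d > 0] from all the bounds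
    ([control_box_interior]). There are finitely many bounds and they are continuous, so near [xe]
    each moves by less than [d / 2]; the remaining [d / 2] is room for the cube
    ([near_shifted_cube_sub_control_box]). The dynamics are affine in the control, so moving [ue]
    into the drift leaves the velocity unchanged ([rhs_shifted_drift]); the path stays the same and
    only the control is translated ([trajectory_shift]). The balance equation at [xe] says that the
    shifted drift vanishes there. *)

Lemma control_box_interior {R : realType} {n m : nat}
    {ulo uhi : 'I_m -> 'rV[R]_n -> R} {x : 'rV[R]_n} {u : 'rV[R]_m} :
  interior (control_box ulo uhi x) u ->
  exists2 d : R, 0 < d & forall i, ulo i x + d <= u 0 i <= uhi i x - d.
Proof.
rewrite /interior => /nbhs_ballP[e /= e0 eB].
exists (e / 2) => [|i]; first by rewrite divr_gt0.
(* In the sup norm, adding [c] to all coordinates at once is a move of size at most [|c|]; the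
   values [e / 2] and [- (e / 2)] then give a margin common to all [i]. *)
have shifted (c : R) : `|c| < e -> control_box ulo uhi x (u + const_mx c).
  move=> ce; apply: eB; split=> // k j.
  by rewrite /ball/= !mxE opprD addrA subrr sub0r normrN.
have e2 : `|e / 2| < e.
  by rewrite gtr0_norm ?divr_gt0// gtr_pMr// invf_lt1// ltr1n.
have /(_ i)/andP[_] := shifted _ e2.
have /(_ i)/andP[+ _] : control_box ulo uhi x (u + const_mx (- (e / 2))).
  by apply: shifted; rewrite normrN.
by rewrite !mxE lerBrDr => -> hi; rewrite lerBrDr.
Qed.

Lemma near_shifted_cube_sub_control_box {R : realType} {n m : nat}
    {ulo uhi : 'I_m -> 'rV[R]_n -> R} {x : 'rV[R]_n} {u : 'rV[R]_m} :
  (forall i, {for x, continuous (ulo i)}) ->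
  (forall i, {for x, continuous (uhi i)}) ->
  interior (control_box ulo uhi x) u ->
  exists2 eps : R, 0 < eps &
    \forall y \near x, [set u + eta | eta in sym_cube eps]
                        `<=` control_box ulo uhi y.
Proof.
move=> ulo_cont uhi_cont /control_box_interior[d d0 du].
have d20 : 0 < d / 2 by rewrite divr_gt0.
(* The margin [d] is split in two: one half absorbs the variation of the bounds, the other the
   perturbation [eta]. *)
exists (d / 2) => //.
have bounds i : \forall y \near x,
    ulo i y < ulo i x + d / 2 /\ uhi i x - d / 2 < uhi i y.
  near=> y; split; near: y.
    by apply: (cvgr_lt (ulo i x)); [exact: ulo_cont|rewrite ltrDl].
  by apply: (cvgr_gt (uhi i x)); [exact: uhi_cont|rewrite gtrBl].
near=> y => _ [eta etaP <-] i.
(* ['I_m] is finite, so the neighborhoods given by [bounds] for the different [i] have a common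
   one. *)
have [] : ulo i y < ulo i x + d / 2 /\ uhi i x - d / 2 < uhi i y.
  by move: i; near: y; exact: filter_forall.
move=> lo hi; have /andP[le1 le2] := etaP i.
have /andP[le3 le4] := du i.
by rewrite mxE; apply/andP; split; lra.
Unshelve. all: by end_near.
Qed.

Lemma Lfuny_bounded d (T : measurableType d) (R : realType)
    (mu : {measure set T -> \bar R}) (f : T -> R) (M : R) :
  measurable_fun setT f -> (forall t, `|f t| <= M) -> f \in Lfun mu +oo%E.
Proof.
move=> mf fM; rewrite inE/=; apply/andP; split; rewrite inE//=.
rewrite /finite_norm unlock; case: ifPn => // _.
apply: (@le_lt_trans _ _ M%:E); last exact: ltry.
by apply/ess_sup_inf.ess_supP; apply: aeW => t /=; rewrite lee_fin.
Qed.

Lemma Linfty_cst {R : realType} {m : nat} (T : R) (v : 'rV[R]_m) :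
  Linfty T (fun=> v).
Proof.
move=> i; apply: (@Lfuny_bounded _ _ _ _ _ `|v 0 i|) => [|t].
  by apply/(measurable_restrictT _ _).1 => //; exact: measurable_cst.
by rewrite patchE; case: ifPn => // _; rewrite normr0.
Qed.

Lemma LinftyD {R : realType} {m : nat} {T : R} {u v : R -> 'rV[R]_m} :
  Linfty T u -> Linfty T v -> Linfty T (fun t => u t + v t).
Proof.
move=> uT vT i.
have addT := (@Lfun_addr_closed _ _ R (@lebesgue_measure R) +oo%E (leey _)).2.
rewrite (_ : _ \_ _ = (fun t => u t 0 i) \_ [set` `]0, T[]
                     + (fun t => v t 0 i) \_ [set` `]0, T[]); first exact: addT.
apply/funext => t; rewrite fctE !patchE mxE.
by case: ifPn => // _; rewrite addr0.
Qed.

Lemma rhs_shifted_drift (R : realType) (n m : nat)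
    (f0 : 'rV[R]_n -> 'rV[R]_n) (g : 'I_m -> 'rV[R]_n -> 'rV[R]_n)
    (u eta : 'rV[R]_m) (x : 'rV[R]_n) :
  rhs (shifted_drift f0 g u) g x eta = rhs f0 g x (u + eta).
Proof.
rewrite /rhs /shifted_drift -addrA -big_split/=; congr (_ + _).
by apply: eq_bigr => i _; rewrite mxE scalerDl.
Qed.

(** Absolute continuity concerns [x] alone, essential boundedness survives adding a constant, and
    the differential equation is the same by [rhs_shifted_drift]. Only the control constraint
    changes, so the inclusion is asked just along the path. *)
Lemma trajectory_shift (R : realType) (n m : nat)
    (f0 : 'rV[R]_n -> 'rV[R]_n) (g : 'I_m -> 'rV[R]_n -> 'rV[R]_n)
    (Omega Omega' : 'rV[R]_n -> set 'rV[R]_m) (u : 'rV[R]_m)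
    (T : R) (x : R -> 'rV[R]_n) (eta : R -> 'rV[R]_m) :
  (forall t, 0 < t < T ->
     [set u + v | v in Omega' (x t)] `<=` Omega (x t)) ->
  trajectory (shifted_drift f0 g u) g Omega' T x eta ->
  trajectory f0 g Omega T x (fun t => u + eta t).
Proof.
move=> sub [x_ac eta_bd x_sol]; split=> //.
  exact: LinftyD (Linfty_cst T u) eta_bd.
move: x_sol; apply: (@filterS _ _ (ae_filter_ringOfSetsType lebesgue_measure)).
move=> t tP tT; have [etaP xP] := tP tT.
split; last by rewrite -rhs_shifted_drift.
by apply: (sub t tT); exists (eta t).
Qed.

Theorem proposition4 (R : realType) (n m : nat) (nu : smoothness)
  (f0 : 'rV[R]_n -> 'rV[R]_n) (g : 'I_m -> 'rV[R]_n -> 'rV[R]_n)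
  (ulo uhi : 'I_m -> 'rV[R]_n -> R)
  (f0_nu : of_class nu f0)
  (g_nu : forall i, of_class nu (g i))
  (ulo_cont : forall i, continuous (ulo i))
  (uhi_cont : forall i, continuous (uhi i))
  (ulo_lt_uhi : forall i x, ulo i x < uhi i x)
  (u_sign : (forall i x, 0 < ulo i x) \/ (forall i x, uhi i x < 0))
  (xe : 'rV[R]_n) (ue : 'rV[R]_m)
  (ueP : (balancing_set f0 g (control_box ulo uhi) xe
            `&` interior (control_box ulo uhi xe)) ue) :
  (exists (Nxe : set 'rV[R]_n) (eps : R),
    [/\ nbhs xe Nxe,
        0 < eps,
        (forall x, Nxe x ->
           [set ue + eta | eta in sym_cube eps] `<=` control_box ulo uhi x) &
        (forall (T : R) (x : R -> 'rV[R]_n) (eta : R -> 'rV[R]_m),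
           0 < T ->
           (forall t, 0 <= t <= T -> Nxe (x t)) ->
           trajectory (shifted_drift f0 g ue) g (fun=> sym_cube eps) T x eta ->
           trajectory f0 g (control_box ulo uhi) T x (fun t => ue + eta t))])
  /\ shifted_drift f0 g ue xe = 0.
Proof.
have [[_ ue_eq] ue_int] := ueP.
(* [shifted_drift f0 g ue xe] and [rhs f0 g xe ue] unfold to the same expression. *)
split; last exact: ue_eq.
have [eps eps0 cubeP] := near_shifted_cube_sub_control_box
  (fun i => ulo_cont i xe) (fun i => uhi_cont i xe) ue_int.
(* The neighborhood is the set of all points where the inclusion holds, so the inclusion is
   immediate and [cubeP] is exactly the neighborhood property. *)
exists [set x | [set ue + eta | eta in sym_cube eps]
                `<=` control_box ulo uhi x], eps; split=> // T x eta T0 xN.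
apply: trajectory_shift => t /andP[t0 tT].
by apply: xN; rewrite !ltW.
Qed.
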